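(* Let $q$ be a prime power and let $G$ be a finite abelian group of exponent $N$ such that $\gcd(q,N)=1$. Let $k$ and $T$ be integers such that $0\le T<k$. Then the number of $q^k$-cyclotomic classes of type $T$ (in $G$) is $$\mathfrak{N}_T(G,q^k)=\sum_{\substack{d\mid N\\ d\in G_{(T,k)}(q,1)}}\frac{\mathcal{N}_G(d)}{\operatorname{ord}_d(q^k)},$$ and the number of $q^k$-cyclotomic classes of type $T'$ is $$\mathfrak{N}_{T'}(G,q^k)=\sum_{\substack{d\mid N\\ d\notin G_{(T,k)}(q,1)}}\frac{\mathcal{N}_G(d)}{\operatorname{ord}_d(q^k)}.$$
   Context: The group $G$ is written additively. The $q^k$-cyclotomic class containing $g\in G$ is $S_{q^k}(g)=\{q^{kj}g: j\ge 0\}$. For $0\le T<k$, the class $S_{q^k}(g)$ is of type $T$ if $S_{q^k}(g)=S_{q^k}(-q^Tg)$, and of type $T'$ otherwise. $\mathcal{N}_G(d)=|\{g\in G:\operatorname{ord}(g)=d\}|$, where $\operatorname{ord}(g)$ is the order of $g$ in $G$. $\operatorname{ord}_d(i)$ is the multiplicative order of $i$ modulo $d$ (with $\operatorname{ord}_1(i)=1$). $G_{(T,k)}(q,1)$ denotes the set of positive integers $d$ such that $d\mid (q^{ks+T}+1)$ for some positive integer $s$. The sums run over positive divisors $d$ of $N$. *)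

(* Defs.v *)
From mathcomp Require Import all_boot all_order all_algebra all_fingroup.
From mathcomp Require Import all_solvable.
From mathcomp Require Import boolp classical_sets.

Set Implicit Arguments.
Unset Strict Implicit.
Unset Printing Implicit Defensive.

Import GRing.Theory.

Local Open Scope ring_scope.

Definition prime_power (q : nat) : Prop :=
  exists p m : nat, [/\ prime p, (0 < m)%N & q = (p ^ m)%N].

(* The least n in {1, ..., d} with i ^ n = 1 modulo d, and the junk value 0
   when there is none; see [mult_orderP]. *)
Definition mult_order (d i : nat) : nat :=
  head 0%N [seq n <- iota 1 d | i ^ n == 1 %[mod d]].

Lemma mult_order1 (i : nat) : mult_order 1 i = 1%N.
Proof. by rewrite /mult_order /= !modn1. Qed.

Lemma mult_orderP (d i : nat) : (0 < d)%N -> coprime i d ->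
  [/\ (0 < mult_order d i)%N, (i ^ mult_order d i = 1 %[mod d])%N
    & forall n, (0 < n)%N -> (i ^ n = 1 %[mod d])%N -> (mult_order d i <= n)%N].
Proof.
move=> d_gt0 co_i_d; rewrite /mult_order.
set P := fun n => _; set s := [seq n <- _ | _].
have s_sorted : sorted leq s.
  by apply: sorted_filter (iota_sorted 1 d) => ? ? ?; apply: leq_trans.
have le_tot : (totient d <= d)%N.
  rewrite totient_count_coprime big_mkord.
  rewrite -[leqRHS]muln1 -[d in leqRHS]card_ord -sum_nat_const.
  by apply: leq_sum => j _; case: coprime.
have tot_s : totient d \in s.
  rewrite mem_filter mem_iota totient_gt0 d_gt0 add1n ltnS le_tot !andbT.
  exact/eqP/Euler_exp_totient.
have head_s : head 0%N s \in s by case: (s) tot_s => //= a l _; rewrite mem_head.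
have head_le n : n \in s -> (head 0%N s <= n)%N.
  case: (s) s_sorted => //= a l; rewrite path_sortedE; last exact: leq_trans.
  by case/andP=> /allP le_al _; rewrite inE => /predU1P[-> //|/le_al].
move: (head_s); rewrite mem_filter mem_iota => /and3P[/eqP P_head head_gt0 _].
split=> // n n_gt0 Pn; have [le_nd|lt_dn] := leqP n d.
  by apply: head_le; rewrite mem_filter mem_iota n_gt0 add1n ltnS le_nd !andbT; apply/eqP.
exact: leq_trans (leq_trans (head_le _ tot_s) le_tot) (ltnW lt_dn).
Qed.

(* The set G_(T,k)(q,1). *)
Definition good_integers (T k q : nat) : set nat :=
  [set d : nat | (0 < d)%N
     /\ exists s : nat, (0 < s)%N /\ (d %| q ^ (k * s + T) + 1)%N]%classic.

Section CyclotomicClasses.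

Variable G : finZmodType.
Implicit Types (g h : G) (C : {set G}) (q k T d : nat).

Definition order_count d : nat := #|[set g : G | #[g]%g == d]|.

Definition cyclotomic_class q k g : {set G} :=
  [set h : G | `[< exists j : nat, h = g *+ q ^ (k * j) >]].

Definition cyclotomic_classes q k : {set {set G}} :=
  [set cyclotomic_class q k g | g : G].

(* A type is a property of a class; it does not depend on the representative
   chosen, see [is_typeE]. *)
Definition is_type T q k C : bool :=
  [exists g : G, (C == cyclotomic_class q k g)
              && (C == cyclotomic_class q k (- (g *+ q ^ T)))].

Lemma mem_cyclotomic_class q k g : g \in cyclotomic_class q k g.
Proof. by rewrite inE; apply/asboolP; exists 0%N; rewrite muln0 mulr1n. Qed.

Lemma is_typeE T q k g :
  is_type T q k (cyclotomic_class q k g)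
  = (cyclotomic_class q k g == cyclotomic_class q k (- (g *+ q ^ T))).
Proof.
have sub a b : cyclotomic_class q k a = cyclotomic_class q k b ->
    cyclotomic_class q k (- (a *+ q ^ T))
      \subset cyclotomic_class q k (- (b *+ q ^ T)).
  move=> eq_ab; move: (mem_cyclotomic_class q k a).
  rewrite eq_ab inE => /asboolP[i ->].
  apply/fintype.subsetP=> x; rewrite inE => /asboolP[j ->]; rewrite inE.
  apply/asboolP; exists (i + j)%N; rewrite -!mulNrn -!mulrnA mulnDr expnD.
  by congr (_ *+ _); rewrite mulnCA mulnA -mulnA mulnCA.
apply/existsP/idP=> [[h /andP[/eqP eq_gh /eqP->]] | eq_g].
  by apply/eqP/setP/fintype.subset_eqP; rewrite !sub.
by exists g; rewrite eqxx.
Qed.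

Definition classes_of_type T q k : {set {set G}} :=
  [set C in cyclotomic_classes q k | is_type T q k C].

Definition classes_of_type' T q k : {set {set G}} :=
  [set C in cyclotomic_classes q k | ~~ is_type T q k C].

End CyclotomicClasses.

(* Main.v *)
Require Import Defs.
From mathcomp Require Import all_boot all_order all_algebra all_fingroup.
From mathcomp Require Import all_solvable.
From mathcomp Require Import boolp classical_sets.
Set Implicit Arguments.
Unset Strict Implicit.
Unset Printing Implicit Defensive.
Import GRing.Theory.
Local Open Scope ring_scope.

(** The [q ^ k]-cyclotomic classes are the orbits of the group generated by
    multiplication by [q ^ k], which is invertible on [G] because [q] is
    prime to the exponent.  Two facts about the class of an element [g] depend
    only on the order [d] of [g]:

    - its size is the multiplicative order of [q ^ k] modulo [d]
      ([card_cyclotomic_class]), since the multiples of [g] correspond to the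
      residues modulo [d];
    - it is of type [T] exactly when [d] is in [good_integers T k q]
      ([is_type_good]): since the classes partition [G], the class of [g] is
      that of [- q ^ T g] if and only if [g = - q ^ (T + k j) g] for some [j],
      which says that [d] divides [q ^ (k j + T) + 1].

    Giving each element the inverse of the size of its class as a weight,
    every class gets total weight 1, so that a number of classes is a sum of
    weights over elements of [G] ([card_classes_sum]).  Both formulas follow
    when this sum is regrouped by the order of the elements
    ([card_classes_by_order]). *)

Lemma coprime_order_exponent (gT : finGroupType) (q : nat) (x : gT) :
  coprime q (exponent [set: gT]) -> coprime q #[x]%g.
Proof. by apply: coprime_dvdr; apply: dvdn_exponent; rewrite inE. Qed.

Lemma eq_mulrn_mod_order (G : finZmodType) (g : G) (m n : nat) :
  (g *+ m == g *+ n) = (m == n %[mod #[g]%g]).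
Proof. by rewrite -!FinRing.zmodXgE eq_expg_mod_order. Qed.

Lemma mult_order_dvd (d i n : nat) : (0 < d)%N -> coprime i d ->
  (i ^ n == 1 %[mod d]) = (mult_order d i %| n)%N.
Proof.
move=> d_gt0 co_id; have [m_gt0 im1 m_min] := mult_orderP d_gt0 co_id.
set m := mult_order d i in m_gt0 im1 m_min *.
have imX a : (i ^ (m * a) = 1 %[mod d])%N by rewrite expnM -modnXm im1 modnXm exp1n.
have eq_r : (i ^ n = i ^ (n %% m) %[mod d])%N.
  rewrite {1}(divn_eq n m) [(_ * m)%N]mulnC expnD.
  by rewrite -modnMml imX modnMml mul1n.
rewrite eq_r /dvdn; apply/eqP/eqP => [i1 | -> //].
have [//|r_gt0] := posnP (n %% m).
by have := m_min _ r_gt0 i1; rewrite leqNgt ltn_mod m_gt0.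
Qed.

Lemma eq_expn_mod_mult_order (d i a b : nat) : (0 < d)%N -> coprime i d ->
  (i ^ a == i ^ b %[mod d]) = (a == b %[mod mult_order d i]).
Proof.
move=> d_gt0 co_id; wlog le_ba : a b / (b <= a)%N.
  move=> IH; case/orP: (leq_total b a) => [/IH // | /IH].
  by rewrite eq_sym => ->; rewrite eq_sym.
rewrite [RHS]eqn_mod_dvd // -mult_order_dvd //.
have [i0 | i_gt0] := posnP i.
  by move: co_id; rewrite i0 /coprime gcd0n => /eqP->; rewrite !modn1.
rewrite !eqn_mod_dvd ?leq_pexp2l ?expn_gt0 ?i_gt0 //.
rewrite -{1}(subnKC le_ba) expnD -{2}[(i ^ b)%N]muln1 -mulnBr.
by rewrite Gauss_dvdr // coprime_sym coprimeXl.
Qed.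

Section Classes.

Variables (G : finZmodType) (q k : nat).
Hypothesis co_q : coprime q (exponent [set: G]).

Let S (g : G) := cyclotomic_class q k g.

Let co_qg (g : G) : coprime q #[g]%g.
Proof. exact: coprime_order_exponent. Qed.

Let co_Qg (g : G) : coprime (q ^ k) #[g]%g.
Proof. by rewrite coprimeXl. Qed.

Lemma cyclotomic_classP (g h : G) :
  reflect (exists j, h = g *+ q ^ (k * j)) (h \in cyclotomic_class q k g).
Proof. by rewrite inE; apply: asboolP. Qed.

Lemma cyclotomic_class_sub (g h : G) :
  h \in cyclotomic_class q k g ->
  cyclotomic_class q k h \subset cyclotomic_class q k g.
Proof.
move=> /cyclotomic_classP[i ->]; apply/fintype.subsetP=> x.
move=> /cyclotomic_classP[j ->]; apply/cyclotomic_classP; exists (i + j)%N.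
by rewrite -mulrnA mulnDr expnD.
Qed.

(** Multiplication by [q ^ k] has finite order on [G], so that its inverse is
    one of its powers. *)
Lemma cyclotomic_class_sym (g h : G) :
  h \in cyclotomic_class q k g -> g \in cyclotomic_class q k h.
Proof.
move=> /cyclotomic_classP[j ->]; apply/cyclotomic_classP.
set m := totient #[g]%g; exists (m.-1 * j)%N.
have m_gt0 : (0 < m)%N by rewrite totient_gt0 order_gt0.
apply/eqP; rewrite -mulrnA -expnD -mulnDr -mulSn prednK // mulnCA expnM.
rewrite -{1}[g]mulr1n eq_mulrn_mod_order eq_sym.
by rewrite -modnXm Euler_exp_totient // modnXm exp1n.
Qed.

Lemma eq_cyclotomic_class (g h : G) :
  (cyclotomic_class q k g == cyclotomic_class q k h)
  = (g \in cyclotomic_class q k h).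
Proof.
apply/eqP/idP => [<- | gh]; first exact: mem_cyclotomic_class.
apply/setP/fintype.subset_eqP.
by rewrite !cyclotomic_class_sub // cyclotomic_class_sym.
Qed.

Lemma card_cyclotomic_class (g : G) :
  #|cyclotomic_class q k g| = mult_order #[g]%g (q ^ k).
Proof.
set m := mult_order _ _; have d_gt0 := order_gt0 g.
have [m_gt0 _ _] := mult_orderP d_gt0 (co_Qg g).
have eqE (i j : nat) :
    (g *+ q ^ (k * i) == g *+ q ^ (k * j)) = (i == j %[mod m]).
  by rewrite eq_mulrn_mod_order !expnM eq_expn_mod_mult_order.
have -> : cyclotomic_class q k g = [set g *+ q ^ (k * i) | i : 'I_m].
  apply/setP=> h; apply/cyclotomic_classP/imsetP => [[j ->] | [i _ ->]].
    exists (Ordinal (ltn_pmod j m_gt0)) => //; apply/eqP.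
    by rewrite eqE modn_mod.
  by exists i.
rewrite card_imset ?card_ord // => i j /eqP; rewrite eqE.
by rewrite !modn_small // => /eqP/val_inj.
Qed.

(** Equality of the two classes is read as membership of [g] in the class of
    [- q ^ T g], rather than the converse: this gives
    [g = - q ^ (k j + T) g] and thus the exponent in [good_integers], where
    the other reading would give [- q ^ T g = q ^ (k j) g]. *)
Lemma is_type_good (T : nat) (g : G) : (0 < k)%N ->
  is_type T q k (cyclotomic_class q k g)
  = (#[g]%g \in good_integers T k q).
Proof.
move=> k_gt0; rewrite is_typeE eq_cyclotomic_class.
have mulE n : (g == - (g *+ n)) = (#[g]%g %| n + 1)%N.
  by rewrite -addr_eq0 -{1}[g]mulr1n -mulrnDr addnC order_dvdn FinRing.zmodXgE.
have mulE' j : (g == - (g *+ q ^ T) *+ q ^ (k * j))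
    = (#[g]%g %| q ^ (k * j + T) + 1)%N.
  by rewrite mulNrn -mulrnA -expnD addnC mulE.
apply/cyclotomic_classP/idP => [[j /eqP] | ].
  rewrite mulE' => dvd_d; rewrite in_setE; split; first exact: order_gt0.
  (* Here [j] may be 0, while [good_integers] asks for a positive [s]: the
     shift is by a period of [q] modulo the order of [g]. *)
  exists (j + totient #[g]%g)%N; split.
    by rewrite addn_gt0 totient_gt0 order_gt0 orbT.
  rewrite mulnDr addnAC expnD [(k * totient _)%N]mulnC expnM.
  rewrite /dvdn -modnDml -modnMmr -modnXm Euler_exp_totient //.
  by rewrite modnXm exp1n modnMmr muln1 modnDml.
rewrite in_setE => -[_ [s [_ dvd_d]]].
by exists s; apply/eqP; rewrite mulE'.
Qed.

Lemma card_classes_sum (R : pred {set G}) :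
  #|[set C in cyclotomic_classes G q k | R C]|%:R
  = \sum_(g : G | R (cyclotomic_class q k g))
      (mult_order #[g]%g (q ^ k))%:R^-1 :> rat.
Proof.
rewrite -sum1_card natr_sum.
rewrite [RHS](partition_big S
  (mem [set C in cyclotomic_classes G q k | R C])) /=; last first.
  by move=> g Rg; rewrite inE Rg imset_f.
apply: eq_bigr => C; rewrite inE => /andP[/imsetP[h _ ->] Rh].
rewrite (eq_bigl [in S h]); last first.
  move=> g; rewrite -[RHS]eq_cyclotomic_class -/(S g) -/(S h).
  by case: (eqVneq (S g) (S h)) => [-> |]; rewrite ?Rh ?andbF.
rewrite (eq_bigr (fun _ => #|S h|%:R^-1)); last first.
  move=> g; rewrite /S -eq_cyclotomic_class => /eqP <-.
  by rewrite card_cyclotomic_class.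
rewrite sumr_const -[RHS]mulr_natr mulVf // Num.Theory.pnatr_eq0 -lt0n.
by apply/card_gt0P; exists h; apply: mem_cyclotomic_class.
Qed.

Lemma card_classes_by_order (R : pred {set G}) (P : pred nat) :
  (forall g, R (cyclotomic_class q k g) = P #[g]%g) ->
  #|[set C in cyclotomic_classes G q k | R C]|%:R
  = \sum_(d <- divisors (exponent [set: G]) | P d)
      (order_count G d)%:R / (mult_order d (q ^ k))%:R :> rat.
Proof.
move=> RP; rewrite card_classes_sum (eq_bigl _ _ RP).
have E d : (order_count G d)%:R / (mult_order d (q ^ k))%:R
    = \sum_(g : G | #[g]%g == d) (mult_order #[g]%g (q ^ k))%:R^-1 :> rat.
  rewrite (eq_bigr (fun _ => (mult_order d (q ^ k))%:R^-1)); last first.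
    by move=> g /eqP->.
  by rewrite sumr_const /order_count cardsE mulr_natl.
rewrite (eq_bigr _ (fun d _ => E d)).
rewrite (exchange_big_dep (fun g : G => P #[g]%g)) /=; last first.
  by move=> d g Pd /eqP->.
apply: eq_bigr => g Pg.
rewrite (eq_bigl (pred1 #[g]%g)); last first.
  by move=> d /=; rewrite [RHS]eq_sym; case: eqP => [<- | _]; rewrite ?Pg ?andbF.
rewrite -big_filter filter_pred1_uniq ?divisors_uniq ?big_seq1 //.
by rewrite -dvdn_divisors ?exponent_gt0 // dvdn_exponent ?inE.
Qed.

End Classes.

Theorem proposition26 (q : nat) (hq : prime_power q)
    (G : finZmodType) (N : nat) (hN : exponent [set: G] = N)
    (hqN : coprime q N) (k T : nat) (hT : (T < k)%N) :
  (#|classes_of_type G T q k|%:R : rat)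
    = \sum_(d <- divisors N | d \in good_integers T k q)
        (order_count G d)%:R / (mult_order d (q ^ k))%:R
  /\
  (#|classes_of_type' G T q k|%:R : rat)
    = \sum_(d <- divisors N | d \notin good_integers T k q)
        (order_count G d)%:R / (mult_order d (q ^ k))%:R.
Proof.
have k_gt0 : (0 < k)%N by apply: leq_ltn_trans hT.
rewrite -hN in hqN *; split.
  by apply: card_classes_by_order => // g; rewrite is_type_good.
by apply: card_classes_by_order => // g; rewrite is_type_good.
Qed.
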